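(* Let $H$ be a Hopf algebra over a field $\Bbbk$ with bijective antipode. Then, when we consider only (associative, not necessarily unital) algebras that either are idempotent or have trivial right or left annihilator (that is, algebras $B$ satisfying at least one of $B^2=B$, $r(B)=0$, $l(B)=0$), there exists a bijective correspondence between algebras in the category ${}_H\mathcal{M}^{par}$ of partial $H$-modules and partial $H$-module algebras with symmetrical partial action.
   Context: $\Bbbk$ is a field; algebras are associative $\Bbbk$-algebras, not necessarily unital; $H$ has comultiplication $\Delta(h)=\sum h_{(1)}\otimes h_{(2)}$ and antipode $S$. For an algebra $A$: $r(A)=\{a\in A: ba=0\ \forall b\in A\}$ is the right annihilator and $l(A)=\{b\in A: ba=0\ \forall a\in A\}$ is the left annihilator; $A^2$ is the span of all products, and $A$ is idempotent if $A^2=A$. A partial action of $H$ on an algebra $A$ is a linear map $\cdot:H\otimes A\to A$ such that for all $a,b\in A$, $h,k\in H$: (1) $1_H\cdot a=a$; (2) $h\cdot(a(k\cdot b))=\sum(h_{(1)}\cdot a)(h_{(2)}k\cdot b)$. Then $A$ is called a partial $H$-module algebra. The partial action is symmetrical if also (3) $h\cdot((k\cdot b)a)=\sum(h_{(1)}k\cdot b)(h_{(2)}\cdot a)$. A partial $H$-module is a vector space $M$ with a linear map $\bullet:H\otimes M\to M$ such that for all $h,k\in H$, $m\in M$: $1_H\bullet m=m$; $\sum h\bullet(k_{(1)}\bullet(S(k_{(2)})\bullet m))=\sum hk_{(1)}\bullet(S(k_{(2)})\bullet m)$; $\sum h_{(1)}\bullet(S(h_{(2)})\bullet(k\bullet m))=\sum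 h_{(1)}\bullet(S(h_{(2)})k\bullet m)$. Morphisms of partial $H$-modules are linear maps commuting with $\bullet$; the category is ${}_H\mathcal{M}^{par}$. Monoidal structure (for $S$ bijective): let $H_{par}$ be the unital algebra through which all partial representations of $H$ factor, generated by symbols $[h]$ ($h\in H$, linear in $h$), so that partial $H$-modules are the same as left $H_{par}$-modules via $[h]m=h\bullet m$. Let $A_{par}\subseteq H_{par}$ be the subalgebra generated by the elements $\epsilon_h=\sum[h_{(1)}][S(h_{(2)})]$. Each partial $H$-module $M$ is an $A_{par}$-bimodule with $\epsilon_h m=\sum h_{(1)}\bullet(S(h_{(2)})\bullet m)$ and $m\,\epsilon_h=\sum h_{(2)}\bullet(S^{-1}(h_{(1)})\bullet m)$. The tensor product of $M$ and $N$ in ${}_H\mathcal{M}^{par}$ is $M\otimes_{A_{par}}N$, with $h\bullet(m\otimes n)=\sum h_{(1)}\bullet m\otimes h_{(2)}\bullet n$. A (not necessarily unital) algebra in ${}_H\mathcal{M}^{par}$ is a partial $H$-module $B$ with an associative multiplication $B\otimes_{A_{par}}B\to B$ which is a morphism of partial $H$-modules. *)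

(* Defs.v *)
From HB Require Import structures.
From mathcomp Require Import all_boot all_algebra.
From mathcomp Require Import boolp classical_sets.
Set Implicit Arguments.
Unset Strict Implicit.
Unset Printing Implicit Defensive.
Import GRing.Theory.
Local Open Scope ring_scope.

Section Tensor.
Variables (k : fieldType) (M N : lmodType k).
Variable bal : (M -> M) -> (N -> N) -> Prop.

Definition formal_scale (a : k) (s : seq (M * N)) : seq (M * N) :=
  [seq (a *: p.1, p.2) | p <- s].

(* A sequence of pairs stands for the formal sum of the pure tensors
   p.1 ⊗ p.2.  The relation is the least congruence that makes ⊗ bilinear
   and satisfies f m ⊗ n = m ⊗ g n whenever [bal f g]: for a ring A, a right
   A-module M and a left A-module N, taking for [bal] the pairs (m |-> m a,
   n |-> a n) with a in A gives the tensor product of M and N over A. *)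
Inductive tensor_eq : seq (M * N) -> seq (M * N) -> Prop :=
| tensor_eq_refl s : tensor_eq s s
| tensor_eq_sym s t : tensor_eq s t -> tensor_eq t s
| tensor_eq_trans s t u : tensor_eq s t -> tensor_eq t u -> tensor_eq s u
| tensor_eq_cat s s' t t' :
    tensor_eq s s' -> tensor_eq t t' -> tensor_eq (s ++ t) (s' ++ t')
| tensor_eq_scale a s t :
    tensor_eq s t -> tensor_eq (formal_scale a s) (formal_scale a t)
| tensor_eq_catC s t : tensor_eq (s ++ t) (t ++ s)
| tensor_eq_0l n : tensor_eq [:: (0, n)] [::]
| tensor_eq_Dl m m' n : tensor_eq [:: (m + m', n)] [:: (m, n); (m', n)]
| tensor_eq_Dr m n n' : tensor_eq [:: (m, n + n')] [:: (m, n); (m, n')]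
| tensor_eq_Z a m n : tensor_eq [:: (a *: m, n)] [:: (m, a *: n)]
| tensor_eq_bal f g m n : bal f g -> tensor_eq [:: (f m, n)] [:: (m, g n)].

Definition tensor_eqb (s t : seq (M * N)) : bool := `[< tensor_eq s t >].

Fact tensor_eqb_equiv : equiv_class_of tensor_eqb.
Proof.
split=> [s|s t|t s u].
- exact/asboolP/tensor_eq_refl.
- by apply/asboolP/asboolP; apply: tensor_eq_sym.
- move=> /asboolP h1 /asboolP h2.
  by apply/asboolP; apply: tensor_eq_trans h1 h2.
Qed.

Canonical tensor_equiv := EquivRelPack tensor_eqb_equiv.
Canonical tensor_encModRel := defaultEncModRel tensor_eqb.

Definition tensor := {eq_quot tensor_equiv}%qT.
HB.instance Definition _ : EqQuotient _ tensor_equiv tensor :=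
  EqQuotient.on tensor.
HB.instance Definition _ := Choice.on tensor.

Definition tclass (s : seq (M * N)) : tensor := \pi_tensor%qT s.

Lemma tclassK x : tclass (repr x) = x.
Proof. exact: reprK. Qed.

Lemma tensor_piP s t : tclass s = tclass t <-> tensor_eq s t.
Proof.
split=> [/eqP|h]; last by apply/eqP; rewrite /tclass eqmodE; apply/asboolP.
by rewrite /tclass eqmodE => /asboolP.
Qed.

Lemma tensor_reprP s : tensor_eq (repr (tclass s)) s.
Proof. by apply/tensor_piP; rewrite tclassK. Qed.

Definition tensor_zero : tensor := tclass [::].
Definition tensor_add (x y : tensor) : tensor := tclass (repr x ++ repr y).
Definition tensor_scale (a : k) (x : tensor) : tensor :=
  tclass (formal_scale a (repr x)).

Fact tensor_addE s t :
  tensor_add (tclass s) (tclass t) = tclass (s ++ t).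
Proof. by apply/tensor_piP; apply: tensor_eq_cat; apply: tensor_reprP. Qed.

Fact tensor_scaleE a s :
  tensor_scale a (tclass s) = tclass (formal_scale a s).
Proof. by apply/tensor_piP; apply: tensor_eq_scale; apply: tensor_reprP. Qed.

Local Opaque tensor_add tensor_scale.

Fact tensor_addA : associative tensor_add.
Proof.
move=> x y z; rewrite -[x]tclassK -[y]tclassK -[z]tclassK.
by rewrite !tensor_addE catA.
Qed.

Fact tensor_addC : commutative tensor_add.
Proof.
move=> x y; rewrite -[x]tclassK -[y]tclassK !tensor_addE.
by apply/tensor_piP; apply: tensor_eq_catC.
Qed.

Fact tensor_add0 : left_id tensor_zero tensor_add.
Proof. by move=> x; rewrite -[x]tclassK tensor_addE. Qed.

(* The additive inverse of x is (-1) x. *)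
Fact tensor_scale0D a b x :
  tensor_scale (a + b) x = tensor_add (tensor_scale a x) (tensor_scale b x).
Proof.
rewrite -[x]tclassK !tensor_scaleE.
elim: (repr x) => [|[m n] s IH]; first by rewrite tensor_add0.
have E c : tclass (formal_scale c ((m, n) :: s)) =
    tensor_add (tclass [:: (c *: m, n)]) (tclass (formal_scale c s)).
  by rewrite tensor_addE.
have D : tclass [:: ((a + b) *: m, n)] =
    tensor_add (tclass [:: (a *: m, n)]) (tclass [:: (b *: m, n)]).
  by rewrite tensor_addE scalerDl; apply/tensor_piP; apply: tensor_eq_Dl.
rewrite !E IH D -!tensor_addA; congr tensor_add.
by rewrite !tensor_addA (tensor_addC (tclass [:: _])).
Qed.

Fact tensor_scale_0 x : tensor_scale 0 x = tensor_zero.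
Proof.
rewrite -[x]tclassK tensor_scaleE.
elim: (repr x) => [|[m n] s IH] //=.
rewrite -cat1s -tensor_addE IH scale0r.
have /tensor_piP -> := tensor_eq_0l n.
exact: tensor_add0.
Qed.

Fact tensor_scale_1 : left_id 1 tensor_scale.
Proof.
move=> x; rewrite -[x]tclassK tensor_scaleE; congr (tclass _).
by rewrite /formal_scale -[RHS]map_id; apply: eq_map => -[m n] /=; rewrite scale1r.
Qed.

Fact tensor_addN : left_inverse tensor_zero (tensor_scale (-1)) tensor_add.
Proof.
move=> x; rewrite -[in X in tensor_add _ X](tensor_scale_1 x).
by rewrite -tensor_scale0D addNr tensor_scale_0.
Qed.

HB.instance Definition _ :=
  GRing.isZmodule.Build tensor tensor_addA tensor_addC tensor_add0 tensor_addN.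

Fact tensor_addrE (x y : tensor) : x + y = tensor_add x y. Proof. by []. Qed.

Fact tensor_scaleA a b x :
  tensor_scale a (tensor_scale b x) = tensor_scale (a * b) x.
Proof.
rewrite -[x]tclassK !tensor_scaleE; congr (tclass _).
by rewrite /formal_scale -map_comp; apply: eq_map => -[m n] /=; rewrite scalerA.
Qed.

Fact tensor_scaleDr : right_distributive tensor_scale +%R.
Proof.
move=> a x y; rewrite -[x]tclassK -[y]tclassK.
rewrite !tensor_addrE !(tensor_addE, tensor_scaleE).
by rewrite /formal_scale map_cat.
Qed.

Fact tensor_scaleDl x : {morph tensor_scale^~ x : a b / a + b}.
Proof. by move=> a b; apply: tensor_scale0D. Qed.

HB.instance Definition _ := GRing.Zmodule_isLmodule.Build k tensor
  tensor_scaleA tensor_scale_1 tensor_scaleDr tensor_scaleDl.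

Definition tpure (m : M) (n : N) : tensor := tclass [:: (m, n)].

Lemma tensor_piE s : tclass s = \sum_(p <- s) tpure p.1 p.2.
Proof.
elim: s => [|[m n] s IH]; first by rewrite big_nil.
by rewrite big_cons -IH -cat1s -tensor_addE.
Qed.

Lemma tensorE (t : tensor) : t = \sum_(p <- repr t) tpure p.1 p.2.
Proof. by rewrite -tensor_piE tclassK. Qed.

(* Independence of the chosen representatives: this is what allows sums over
   [repr t] to be used as Sweedler sums. *)
Lemma tensor_eq_sum (V : lmodType k) (f : M -> N -> V) s t :
  (forall n, linear (f^~ n)) -> (forall m, linear (f m)) ->
  (forall a b m n, bal a b -> f (a m) n = f m (b n)) ->
  tensor_eq s t -> \sum_(p <- s) f p.1 p.2 = \sum_(p <- t) f p.1 p.2.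
Proof.
move=> fl fr fb.
have fZl a m n : f (a *: m) n = a *: f m n.
  have f0 : f 0 n = 0.
    by have := fl n 1 0 0; rewrite !scale1r addr0 -{1}[f 0 n]addr0 => /addrI.
  by have := fl n a m 0; rewrite addr0 f0 addr0.
have fZr a m n : f m (a *: n) = a *: f m n.
  have f0 : f m 0 = 0.
    by have := fr m 1 0 0; rewrite !scale1r addr0 -{1}[f m 0]addr0 => /addrI.
  by have := fr m a n 0; rewrite addr0 f0 addr0.
elim=> {s t} //=.
- by move=> s t u _ -> _ ->.
- by move=> s s' t t' _ h1 _ h2; rewrite !big_cat /= h1 h2.
- move=> a s t _ h; rewrite /formal_scale !big_map /=.
  under eq_bigr do rewrite fZl.
  under [RHS]eq_bigr do rewrite fZl.
  by rewrite -!scaler_sumr h.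
- by move=> s t; rewrite !big_cat /= addrC.
- by move=> n; rewrite big_seq1 big_nil /= -(scale0r (0 : M)) fZl scale0r.
- move=> m m' n; rewrite big_seq1 big_cons big_seq1 /=.
  by have := fl n 1 m m'; rewrite !scale1r.
- move=> m n n'; rewrite big_seq1 big_cons big_seq1 /=.
  by have := fr m 1 n n'; rewrite !scale1r.
- by move=> a m n; rewrite !big_seq1 /= fZl fZr.
- by move=> f0 g0 m n h; rewrite !big_seq1 /=; apply: fb.
Qed.

End Tensor.

Arguments tpure {k M N bal}.

Definition tensor_k (k : fieldType) (M N : lmodType k) : lmodType k :=
  tensor (fun (_ : M -> M) (_ : N -> N) => False).

Local Notation "m ⊗ n" := (tpure m n) (at level 40, left associativity).

(* Sums over [repr (comul h)] are the Sweedler sums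
   h_(1) ⊗ h_(2) = comul h. *)
Record hopfAlgebra (k : fieldType) := HopfAlgebra {
  hopf_alg :> algType k;
  comul : hopf_alg -> tensor_k hopf_alg hopf_alg;
  counit : hopf_alg -> k;
  antipode : hopf_alg -> hopf_alg;
  comul_linear : linear comul;
  counit_linear : linear (counit : hopf_alg -> k^o);
  antipode_linear : linear antipode;
  comulA : forall h,
    \sum_(p <- repr (comul h)) \sum_(q <- repr (comul p.1))
      (q.1 ⊗ (q.2 ⊗ p.2) : tensor_k hopf_alg (tensor_k hopf_alg hopf_alg)) =
    \sum_(p <- repr (comul h)) \sum_(q <- repr (comul p.2))
      (p.1 ⊗ (q.1 ⊗ q.2));
  counit_comull : forall h, \sum_(p <- repr (comul h)) counit p.1 *: p.2 = h;
  counit_comulr : forall h, \sum_(p <- repr (comul h)) counit p.2 *: p.1 = h;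
  comul1 : comul 1 = 1 ⊗ 1;
  comulM : forall g h, comul (g * h) =
    \sum_(p <- repr (comul g)) \sum_(q <- repr (comul h))
      (p.1 * q.1) ⊗ (p.2 * q.2);
  counit1 : counit 1 = 1;
  counitM : forall g h, counit (g * h) = counit g * counit h;
  antipodel : forall h,
    \sum_(p <- repr (comul h)) antipode p.1 * p.2 = counit h *: 1;
  antipoder : forall h,
    \sum_(p <- repr (comul h)) p.1 * antipode p.2 = counit h *: 1
}.

Definition sweedler (k : fieldType) (H : hopfAlgebra k) (h : H) : seq (H * H) :=
  repr (comul h).

(* The inverse function of the antipode; meaningful only when the antipode is
   bijective. *)
Definition antipode_inv (k : fieldType) (H : hopfAlgebra k) (h : H) : H :=
  xget 0 [set g | antipode g = h]%classic.

Record partial_module (k : fieldType) (H : hopfAlgebra k) (M : lmodType k) :=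
  PartialModule {
  pact :> H -> M -> M;
  pact_linearl : forall m, linear (pact^~ m);
  pact_linearr : forall h, linear (pact h);
  pact1 : forall m, pact 1 m = m;
  pactMl : forall h g m,
    \sum_(p <- sweedler g) pact h (pact p.1 (pact (antipode p.2) m)) =
    \sum_(p <- sweedler g) pact (h * p.1) (pact (antipode p.2) m);
  pactMr : forall h g m,
    \sum_(p <- sweedler h) pact p.1 (pact (antipode p.2) (pact g m)) =
    \sum_(p <- sweedler h) pact p.1 (pact (antipode p.2 * g) m)
}.

Section Hpar.
Variables (k : fieldType) (H : hopfAlgebra k).

Inductive hpar_term : Type :=
| HGen of H
| HZero
| HAdd of hpar_term & hpar_term
| HScale of k & hpar_term
| HOne
| HMul of hpar_term & hpar_term.

HB.instance Definition _ := gen_eqMixin hpar_term.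
HB.instance Definition _ := gen_choiceMixin hpar_term.

(* The congruence of k-algebras generated by the linearity of h |-> [h] and the
   three relations defining partial representations. *)
Inductive hpar_eq : hpar_term -> hpar_term -> Prop :=
| hpar_refl s : hpar_eq s s
| hpar_sym s t : hpar_eq s t -> hpar_eq t s
| hpar_trans s t u : hpar_eq s t -> hpar_eq t u -> hpar_eq s u
| hpar_congrD s s' t t' :
    hpar_eq s s' -> hpar_eq t t' -> hpar_eq (HAdd s t) (HAdd s' t')
| hpar_congrZ a s t : hpar_eq s t -> hpar_eq (HScale a s) (HScale a t)
| hpar_congrM s s' t t' :
    hpar_eq s s' -> hpar_eq t t' -> hpar_eq (HMul s t) (HMul s' t')
| hpar_addA s t u : hpar_eq (HAdd s (HAdd t u)) (HAdd (HAdd s t) u)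
| hpar_addC s t : hpar_eq (HAdd s t) (HAdd t s)
| hpar_add0 s : hpar_eq (HAdd HZero s) s
| hpar_scale0 s : hpar_eq (HScale 0 s) HZero
| hpar_scale1 s : hpar_eq (HScale 1 s) s
| hpar_scaleA a b s : hpar_eq (HScale a (HScale b s)) (HScale (a * b) s)
| hpar_scaleDr a s t :
    hpar_eq (HScale a (HAdd s t)) (HAdd (HScale a s) (HScale a t))
| hpar_scaleDl a b s :
    hpar_eq (HScale (a + b) s) (HAdd (HScale a s) (HScale b s))
| hpar_mulA s t u : hpar_eq (HMul s (HMul t u)) (HMul (HMul s t) u)
| hpar_mul1l s : hpar_eq (HMul HOne s) s
| hpar_mul1r s : hpar_eq (HMul s HOne) s
| hpar_mulDl s t u : hpar_eq (HMul (HAdd s t) u) (HAdd (HMul s u) (HMul t u))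
| hpar_mulDr s t u : hpar_eq (HMul s (HAdd t u)) (HAdd (HMul s t) (HMul s u))
| hpar_scaleAl a s t : hpar_eq (HScale a (HMul s t)) (HMul (HScale a s) t)
| hpar_scaleAr a s t : hpar_eq (HScale a (HMul s t)) (HMul s (HScale a t))
| hpar_gen_linear a g h :
    hpar_eq (HGen (a *: g + h)) (HAdd (HScale a (HGen g)) (HGen h))
| hpar_gen1 : hpar_eq (HGen 1) HOne
| hpar_genMl h g :
    hpar_eq
      (\big[HAdd/HZero]_(p <- sweedler g)
         HMul (HGen h) (HMul (HGen p.1) (HGen (antipode p.2))))
      (\big[HAdd/HZero]_(p <- sweedler g)
         HMul (HGen (h * p.1)) (HGen (antipode p.2)))
| hpar_genMr h g :
    hpar_eq
      (\big[HAdd/HZero]_(p <- sweedler h)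
         HMul (HGen p.1) (HMul (HGen (antipode p.2)) (HGen g)))
      (\big[HAdd/HZero]_(p <- sweedler h)
         HMul (HGen p.1) (HGen (antipode p.2 * g))).

Definition hpar_eqb (s t : hpar_term) : bool := `[< hpar_eq s t >].

Fact hpar_eqb_equiv : equiv_class_of hpar_eqb.
Proof.
split=> [s|s t|t s u].
- exact/asboolP/hpar_refl.
- by apply/asboolP/asboolP; apply: hpar_sym.
- move=> /asboolP h1 /asboolP h2.
  by apply/asboolP; apply: hpar_trans h1 h2.
Qed.

Canonical hpar_equiv := EquivRelPack hpar_eqb_equiv.
Canonical hpar_encModRel := defaultEncModRel hpar_eqb.

Definition Hpar := {eq_quot hpar_equiv}%qT.
HB.instance Definition _ : EqQuotient _ hpar_equiv Hpar := EqQuotient.on Hpar.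
HB.instance Definition _ := Choice.on Hpar.

Definition hclass (s : hpar_term) : Hpar := \pi_Hpar%qT s.

Lemma hclassK x : hclass (repr x) = x.
Proof. exact: reprK. Qed.

Lemma hpar_piP s t : hclass s = hclass t <-> hpar_eq s t.
Proof.
split=> [/eqP|h]; last by apply/eqP; rewrite /hclass eqmodE; apply/asboolP.
by rewrite /hclass eqmodE => /asboolP.
Qed.

Lemma hpar_reprP s : hpar_eq (repr (hclass s)) s.
Proof. by apply/hpar_piP; rewrite hclassK. Qed.

Fixpoint term_act (M : lmodType k) (P : H -> M -> M) (s : hpar_term) (m : M)
    {struct s} : M :=
  match s with
  | HGen h => P h m
  | HZero => 0
  | HAdd s t => term_act P s m + term_act P t m
  | HScale a s => a *: term_act P s m
  | HOne => m
  | HMul s t => term_act P s (term_act P t m)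
  end.

Lemma term_act_linear (M : lmodType k) (P : partial_module H M) s :
  linear (term_act P s).
Proof.
elim: s => [h|| s IHs t IHt|b s IHs||s IHs t IHt] a m n /=.
- exact: pact_linearr.
- by rewrite scaler0 addr0.
- by rewrite IHs IHt scalerDr addrACA.
- by rewrite IHs scalerDr !scalerA mulrC.
- by [].
- by rewrite IHt IHs.
Qed.

Lemma term_act_sum (M : lmodType k) (P : H -> M -> M) (I : Type) (r : seq I)
    (F : I -> hpar_term) m :
  term_act P (\big[HAdd/HZero]_(i <- r) F i) m = \sum_(i <- r) term_act P (F i) m.
Proof. by elim: r => [|i r IH]; rewrite ?big_nil ?big_cons //= IH. Qed.

Lemma term_act_eq (M : lmodType k) (P : partial_module H M) s t m :
  hpar_eq s t -> term_act P s m = term_act P t m.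
Proof.
move=> e; elim: e m => {s t} /=.
- by [].
- by move=> s t _ IH m; rewrite IH.
- by move=> s t u _ IH1 _ IH2 m; rewrite IH1.
- by move=> s s' t t' _ IH1 _ IH2 m; rewrite IH1 IH2.
- by move=> a s t _ IH m; rewrite IH.
- by move=> s s' t t' _ IH1 _ IH2 m; rewrite IH1 IH2.
- by move=> *; rewrite addrA.
- by move=> *; rewrite addrC.
- by move=> *; rewrite add0r.
- by move=> *; rewrite scale0r.
- by move=> *; rewrite scale1r.
- by move=> *; rewrite scalerA.
- by move=> *; rewrite scalerDr.
- by move=> *; rewrite scalerDl.
- by [].
- by [].
- by [].
- by [].
- move=> s t u m; have := term_act_linear P s 1 (term_act P t m) (term_act P u m).
  by rewrite !scale1r.
- by [].
- move=> a s t m; have := term_act_linear P s a (term_act P t m) 0.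
  have -> : term_act P s 0 = 0.
    have := term_act_linear P s 1 0 0.
    by rewrite !scale1r addr0 -{1}[term_act P s 0]addr0 => /addrI.
  by rewrite !addr0 => ->.
- by move=> *; apply: pact_linearl.
- exact: pact1.
- by move=> h g m; rewrite !term_act_sum; apply: pactMl.
- by move=> h g m; rewrite !term_act_sum; apply: pactMr.
Qed.

Definition hpar_zero : Hpar := hclass HZero.
Definition hpar_one : Hpar := hclass HOne.
Definition hpar_add (x y : Hpar) : Hpar := hclass (HAdd (repr x) (repr y)).
Definition hpar_mul (x y : Hpar) : Hpar := hclass (HMul (repr x) (repr y)).
Definition hpar_scale (a : k) (x : Hpar) : Hpar := hclass (HScale a (repr x)).

Fact hpar_addE s t : hpar_add (hclass s) (hclass t) = hclass (HAdd s t).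
Proof. by apply/hpar_piP; apply: hpar_congrD; apply: hpar_reprP. Qed.

Fact hpar_mulE s t : hpar_mul (hclass s) (hclass t) = hclass (HMul s t).
Proof. by apply/hpar_piP; apply: hpar_congrM; apply: hpar_reprP. Qed.

Fact hpar_scaleE a s : hpar_scale a (hclass s) = hclass (HScale a s).
Proof. by apply/hpar_piP; apply: hpar_congrZ; apply: hpar_reprP. Qed.

Local Opaque hpar_add hpar_mul hpar_scale.

Let hparE := (hpar_addE, hpar_mulE, hpar_scaleE).

Fact hpar_addrA : associative hpar_add.
Proof.
move=> x y z; rewrite -[x]hclassK -[y]hclassK -[z]hclassK !hparE.
by apply/hpar_piP; apply: hpar_addA.
Qed.

Fact hpar_addrC : commutative hpar_add.
Proof.
move=> x y; rewrite -[x]hclassK -[y]hclassK !hparE.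
by apply/hpar_piP; apply: hpar_addC.
Qed.

Fact hpar_add0r : left_id hpar_zero hpar_add.
Proof. by move=> x; rewrite -[x]hclassK !hparE; apply/hpar_piP; apply: hpar_add0. Qed.

Fact hpar_addNr : left_inverse hpar_zero (hpar_scale (-1)) hpar_add.
Proof.
move=> x; rewrite -[x]hclassK !hparE; apply/hpar_piP.
apply: hpar_trans (hpar_scale0 (repr x)).
rewrite -(addNr (1 : k)); apply: hpar_sym.
apply: hpar_trans (hpar_scaleDl _ _ _) _.
apply: hpar_congrD; [exact: hpar_refl | exact: hpar_scale1].
Qed.

HB.instance Definition _ :=
  GRing.isZmodule.Build Hpar hpar_addrA hpar_addrC hpar_add0r hpar_addNr.

Fact hpar_addrE (x y : Hpar) : x + y = hpar_add x y. Proof. by []. Qed.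

Fact hpar_mulrA : associative hpar_mul.
Proof.
move=> x y z; rewrite -[x]hclassK -[y]hclassK -[z]hclassK !hparE.
by apply/hpar_piP; apply: hpar_mulA.
Qed.

Fact hpar_mul1 : left_id hpar_one hpar_mul.
Proof. by move=> x; rewrite -[x]hclassK !hparE; apply/hpar_piP; apply: hpar_mul1l. Qed.

Fact hpar_mulr1 : right_id hpar_one hpar_mul.
Proof. by move=> x; rewrite -[x]hclassK !hparE; apply/hpar_piP; apply: hpar_mul1r. Qed.

Fact hpar_mulrDl : left_distributive hpar_mul +%R.
Proof.
move=> x y z; rewrite -[x]hclassK -[y]hclassK -[z]hclassK !hpar_addrE !hparE.
by apply/hpar_piP; apply: hpar_mulDl.
Qed.

Fact hpar_mulrDr : right_distributive hpar_mul +%R.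
Proof.
move=> x y z; rewrite -[x]hclassK -[y]hclassK -[z]hclassK !hpar_addrE !hparE.
by apply/hpar_piP; apply: hpar_mulDr.
Qed.

(* Through the counit, k is a partial module on which 1 and 0 act
   differently. *)
Definition counit_act (h : H) (a : k^o) : k^o := counit h * a.

Fact hpar_one_neq0 : hpar_one != 0.
Proof.
have lin1 m : linear (counit_act^~ m).
  by move=> a g h; rewrite /counit_act counit_linear mulrDl -mulrA.
have lin2 h : linear (counit_act h).
  by move=> a m n; rewrite /counit_act mulrDr mulrCA.
have act1 m : counit_act 1 m = m by rewrite /counit_act counit1 mul1r.
have actM g h m : counit_act g (counit_act h m) = counit_act (g * h) m.
  by rewrite /counit_act counitM mulrA.
pose P := @PartialModule k H k^o counit_act lin1 lin2 act1
  (fun h g m => eq_bigr _ (fun p _ => actM _ _ _))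
  (fun h g m => eq_bigr _ (fun p _ => congr1 _ (actM _ _ _))).
apply/negP => /eqP /hpar_piP /(term_act_eq P (1 : k^o)) /= /eqP.
by rewrite oner_eq0.
Qed.

HB.instance Definition _ := GRing.Zmodule_isNzRing.Build Hpar
  hpar_mulrA hpar_mul1 hpar_mulr1 hpar_mulrDl hpar_mulrDr hpar_one_neq0.

Fact hpar_mulrE (x y : Hpar) : x * y = hpar_mul x y. Proof. by []. Qed.

Fact hpar_scalerA a b x : hpar_scale a (hpar_scale b x) = hpar_scale (a * b) x.
Proof. by rewrite -[x]hclassK !hparE; apply/hpar_piP; apply: hpar_scaleA. Qed.

Fact hpar_scale1r : left_id 1 hpar_scale.
Proof. by move=> x; rewrite -[x]hclassK !hparE; apply/hpar_piP; apply: hpar_scale1. Qed.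

Fact hpar_scalerDr : right_distributive hpar_scale +%R.
Proof.
move=> a x y; rewrite -[x]hclassK -[y]hclassK !hpar_addrE !hparE.
by apply/hpar_piP; apply: hpar_scaleDr.
Qed.

Fact hpar_scalerDl x : {morph hpar_scale^~ x : a b / a + b}.
Proof.
move=> a b; rewrite -[x]hclassK !hpar_addrE !hparE.
by apply/hpar_piP; apply: hpar_scaleDl.
Qed.

HB.instance Definition _ := GRing.Zmodule_isLmodule.Build k Hpar
  hpar_scalerA hpar_scale1r hpar_scalerDr hpar_scalerDl.

Fact hpar_scalerE a (x : Hpar) : a *: x = hpar_scale a x. Proof. by []. Qed.

Fact hpar_scalerAl a (x y : Hpar) : a *: (x * y) = (a *: x) * y.
Proof.
rewrite -[x]hclassK -[y]hclassK !hpar_mulrE !hpar_scalerE !hparE.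
by apply/hpar_piP; apply: hpar_scaleAl.
Qed.

HB.instance Definition _ := GRing.Lmodule_isLalgebra.Build k Hpar hpar_scalerAl.

Fact hpar_scalerAr a (x y : Hpar) : a *: (x * y) = x * (a *: y).
Proof.
rewrite -[x]hclassK -[y]hclassK !hpar_mulrE !hpar_scalerE !hparE.
by apply/hpar_piP; apply: hpar_scaleAr.
Qed.

HB.instance Definition _ := GRing.Lalgebra_isAlgebra.Build k Hpar hpar_scalerAr.

Definition hpar_gen (h : H) : Hpar := hclass (HGen h).

Definition hpar_eps (h : H) : Hpar :=
  \sum_(p <- sweedler h) hpar_gen p.1 * hpar_gen (antipode p.2).

Inductive Apar : Hpar -> Prop :=
| Apar_eps h : Apar (hpar_eps h)
| Apar_1 : Apar 1
| Apar_linear c a b : Apar a -> Apar b -> Apar (c *: a + b)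
| Apar_M a b : Apar a -> Apar b -> Apar (a * b).

Section Action.
Variables (M : lmodType k) (P : partial_module H M).

Definition hpar_act (x : Hpar) (m : M) : M := term_act P (repr x) m.

Lemma hpar_act_pi s m : hpar_act (hclass s) m = term_act P s m.
Proof. exact/term_act_eq/hpar_reprP. Qed.

Lemma hpar_act_gen h m : hpar_act (hpar_gen h) m = P h m.
Proof. by rewrite hpar_act_pi. Qed.

Lemma hpar_act1 m : hpar_act 1 m = m.
Proof. by rewrite [1]/(hclass HOne) hpar_act_pi. Qed.

Lemma hpar_actM x y m : hpar_act (x * y) m = hpar_act x (hpar_act y m).
Proof. by rewrite -[in LHS](hclassK x) -[in LHS](hclassK y) hpar_mulrE hpar_mulE hpar_act_pi. Qed.

Lemma hpar_act_linearl m : linear (hpar_act^~ m).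
Proof.
move=> a x y; rewrite /= -[in LHS](hclassK x) -[in LHS](hclassK y).
by rewrite hpar_addrE hpar_scalerE hpar_scaleE hpar_addE hpar_act_pi.
Qed.

Lemma hpar_act_linearr x : linear (hpar_act x).
Proof. exact: term_act_linear. Qed.

(* [Apar_ract a f] means that a is in Apar and that f is m |-> m a for the
   right Apar-module structure of M, which is determined by its values on the
   generators hpar_eps h of Apar. *)
Inductive Apar_ract : Hpar -> (M -> M) -> Prop :=
| Apar_ract_eps h : Apar_ract (hpar_eps h)
    (fun m => \sum_(p <- sweedler h) P p.2 (P (antipode_inv p.1) m))
| Apar_ract1 : Apar_ract 1 id
| Apar_ract_linear c a b f g : Apar_ract a f -> Apar_ract b g ->
    Apar_ract (c *: a + b) (fun m => c *: f m + g m)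
| Apar_ractM a b f g : Apar_ract a f -> Apar_ract b g ->
    Apar_ract (a * b) (fun m => g (f m)).

Lemma AparP a : Apar a <-> exists f, Apar_ract a f.
Proof.
split=> [|[f]].
  elim=> {a} [h||c a b _ [f hf] _ [g hg]|a b _ [f hf] _ [g hg]].
  - by eexists; apply: Apar_ract_eps.
  - by eexists; apply: Apar_ract1.
  - by eexists; apply: Apar_ract_linear hf hg.
  - by eexists; apply: Apar_ractM hf hg.
by elim=> *; constructor.
Qed.

End Action.

(* m a ⊗ n = m ⊗ a n for all a in Apar. *)
Definition tensor_Apar (M N : lmodType k) (P : partial_module H M)
    (Q : partial_module H N) : lmodType k :=
  tensor (fun (f : M -> M) (g : N -> N) =>
    exists2 a, Apar_ract P a f & g = hpar_act Q a).

End Hpar.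

(* A not necessarily unital algebra in the monoidal category of partial
   H-modules, with underlying vector space B.  In [pa_mul_morph] the action on
   the source is h (a ⊗ b) = h_(1) a ⊗ h_(2) b; checking it on pure tensors is
   enough since they span the tensor product ([tensorE]). *)
Record par_algebra (k : fieldType) (H : hopfAlgebra k) (B : lmodType k) :=
  ParAlgebra {
  pa_module :> partial_module H B;
  pa_mul : tensor_Apar pa_module pa_module -> B;
  pa_mul_linear : linear pa_mul;
  pa_mulA : forall a b c,
    pa_mul (pa_mul (a ⊗ b) ⊗ c) = pa_mul (a ⊗ pa_mul (b ⊗ c));
  pa_mul_morph : forall h a b,
    pa_module h (pa_mul (a ⊗ b)) =
    pa_mul (\sum_(p <- sweedler h) (pa_module p.1 a ⊗ pa_module p.2 b))
}.

Definition pa_prod (k : fieldType) (H : hopfAlgebra k) (B : lmodType k)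
  (A : par_algebra H B) (a b : B) : B := pa_mul (p := A) (a ⊗ b).

Record partial_module_algebra (k : fieldType) (H : hopfAlgebra k)
    (B : lmodType k) := PartialModuleAlgebra {
  pma_prod : B -> B -> B;
  pma_prod_linearl : forall b, linear (pma_prod^~ b);
  pma_prod_linearr : forall a, linear (pma_prod a);
  pma_prodA : associative pma_prod;
  pma_act : H -> B -> B;
  pma_act_linearl : forall b, linear (pma_act^~ b);
  pma_act_linearr : forall h, linear (pma_act h);
  pma_act1 : forall a, pma_act 1 a = a;
  pma_actM : forall h g a b,
    pma_act h (pma_prod a (pma_act g b)) =
    \sum_(p <- sweedler h) pma_prod (pma_act p.1 a) (pma_act (p.2 * g) b)
}.

Definition symmetrical (k : fieldType) (H : hopfAlgebra k) (B : lmodType k)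
    (A : partial_module_algebra H B) : Prop :=
  forall h g a b,
    pma_act A h (pma_prod A (pma_act A g b) a) =
    \sum_(p <- sweedler h)
      pma_prod A (pma_act A (p.1 * g) b) (pma_act A p.2 a).

Section Admissible.
Variables (B : zmodType) (prod : B -> B -> B).

Definition idempotent_prod : Prop :=
  forall a, exists s : seq (B * B), a = \sum_(p <- s) prod p.1 p.2.

Definition right_annihilator : set B := [set a | forall b, prod b a = 0]%classic.

Definition left_annihilator : set B := [set b | forall a, prod b a = 0]%classic.

Definition admissible_prod : Prop :=
  [\/ idempotent_prod, right_annihilator = [set 0]%classic
    | left_annihilator = [set 0]%classic].

End Admissible.

(* Main.v *)
(* Write ε_h m = h1 • (S(h2) • m) and m ε_h = h2 • (S^-1(h1) • m).

   Given an algebra of partial modules, h • (k • b) = ε_h1 (h2 k • b) =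
   (h1 k • b) ε_h2, and every ε can be moved across the product because the
   latter is balanced over A_par: this turns the morphism property
   h • (a b) = (h1 • a)(h2 • b) into the two axioms of a symmetrical partial
   action.

   Conversely, a symmetrical partial action always satisfies
   (c ε_h) m = c (ε_h m), and it satisfies the axioms of a partial module at
   every product a b.  The identity (h • a) b = h1 • (a (S(h2) • b)) propagates
   them from products to all elements when l(A) = 0.  When r(A) = 0, the
   opposite algebra is a symmetrical partial module algebra over the
   coopposite Hopf algebra, whose antipode is S^-1; this gives the axioms in
   the form h • (S(k1) • (k2 • m)) = h S(k1) • (k2 • m) and
   S(h1) • (h2 • (k • m)) = S(h1) • (h2 k • m), which imply the usual ones. *)
Require Import Defs.
From mathcomp Require Import all_boot all_algebra.
From mathcomp Require Import boolp classical_sets.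
Import GRing.Theory.
Local Open Scope ring_scope.
Set Implicit Arguments.
Unset Strict Implicit.
Unset Printing Implicit Defensive.

Local Notation "m ⊗ n" := (tpure m n) (at level 40, left associativity).

(** * Closure properties of linear maps, and maps induced on tensor products *)

Section Linear.
Variable k : fieldType.
Implicit Types U V W : lmodType k.

Lemma linear0_fun U V (f : U -> V) : linear f -> f 0 = 0.
Proof. by move=> fl; have := fl (-1) 0 0; rewrite scaler0 add0r scaleN1r addNr. Qed.

Lemma linearD_fun U V (f : U -> V) : linear f -> {morph f : x y / x + y}.
Proof. by move=> fl x y; have := fl 1 x y; rewrite !scale1r. Qed.

Lemma linearZ_fun U V (f : U -> V) : linear f -> scalable f.
Proof. by move=> fl a x; have := fl a x 0; rewrite (linear0_fun fl) !addr0. Qed.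

Lemma linear_sum_fun U V (f : U -> V) : linear f ->
  forall I (r : seq I) F, f (\sum_(i <- r) F i) = \sum_(i <- r) f (F i).
Proof.
by move=> fl I r F; apply: (big_morph f (linearD_fun fl) (linear0_fun fl)).
Qed.

Lemma linear_id U : linear (fun x : U => x).
Proof. by []. Qed.

Lemma linear_comp U V W (g : V -> W) (f : U -> V) :
  linear g -> linear f -> linear (fun x => g (f x)).
Proof. by move=> gl fl a x y; rewrite fl gl. Qed.

Lemma linear_sum U V I (r : seq I) (F : I -> U -> V) :
  (forall i, linear (F i)) -> linear (fun x => \sum_(i <- r) F i x).
Proof.
move=> Fl a x y; rewrite scaler_sumr -big_split /=.
by apply: eq_bigr => i _; rewrite Fl.
Qed.

Lemma linear_scale U V c (f : U -> V) :
  linear f -> linear (fun x => c *: f x).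
Proof. by move=> fl a x y; rewrite fl scalerDr !scalerA mulrC. Qed.

Lemma linear_scalel U V (f : U -> k^o) (v : V) :
  linear f -> linear (fun x => (f x : k) *: v).
Proof. by move=> fl a x y; rewrite fl scalerDl scalerA. Qed.

End Linear.

Section TensorSum.
Variables (k : fieldType) (M N V : lmodType k).
Variable bal : (M -> M) -> (N -> N) -> Prop.
Variable f : M -> N -> V.
Hypothesis fl : forall n, linear (f^~ n).
Hypothesis fr : forall m, linear (f m).
Hypothesis fb : forall a b m n, bal a b -> f (a m) n = f m (b n).

Definition tensor_sum (t : tensor bal) : V := \sum_(p <- repr t) f p.1 p.2.

Lemma tensor_sum_class s : tensor_sum (tclass bal s) = \sum_(p <- s) f p.1 p.2.
Proof. by apply: (tensor_eq_sum fl fr fb); apply: tensor_reprP. Qed.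

Lemma tensor_sum_pure m n : tensor_sum (m ⊗ n) = f m n.
Proof. by rewrite tensor_sum_class big_seq1. Qed.

Lemma tensor_sum_linear : linear tensor_sum.
Proof.
move=> a x y; rewrite -[in LHS](tclassK x) -[in LHS](tclassK y).
rewrite [_ *: _]tensor_scaleE [_ + _]tensor_addE.
rewrite tensor_sum_class big_cat /=; congr (_ + _).
rewrite /formal_scale big_map /= scaler_sumr; apply: eq_bigr => p _.
exact: (linearZ_fun (fl _)).
Qed.

End TensorSum.

(** * Sums over a comultiplication *)

Section Sweedler.
Variables (k : fieldType) (H : hopfAlgebra k).
Implicit Types (U V : lmodType k) (g h : H).

(** A functional of the summand, so that coassociativity and the antipode laws become rewriting
    rules for nested sums. *)
Definition sw V h (f : H -> H -> V) : V := \sum_(p <- sweedler h) f p.1 p.2.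

Lemma eq_sw V h (f f' : H -> H -> V) :
  (forall x y, f x y = f' x y) -> sw h f = sw h f'.
Proof. by move=> e; apply: eq_bigr. Qed.

Lemma sw_comul V h (f : H -> H -> V) :
  sw h f = tensor_sum (bal := fun _ _ => False) f (comul h).
Proof. by []. Qed.

Lemma raddf_sw U V (a : U -> V) h (f : H -> H -> U) :
  linear a -> a (sw h f) = sw h (fun x y => a (f x y)).
Proof. by move=> al; rewrite /sw linear_sum_fun. Qed.

Lemma exchange_sw V g h (f : H -> H -> H -> H -> V) :
  sw g (fun x y => sw h (fun u v => f x y u v)) =
  sw h (fun u v => sw g (fun x y => f x y u v)).
Proof. exact: exchange_big. Qed.

Lemma linear_sw_arg U V h (f : H -> H -> U -> V) :
  (forall x y, linear (f x y)) -> linear (fun z => sw h (fun x y => f x y z)).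
Proof. by move=> fl; apply: linear_sum => p. Qed.

Lemma linear_sw U V (a : U -> H) (f : H -> H -> V) :
  (forall y, linear (f^~ y)) -> (forall x, linear (f x)) -> linear a ->
  linear (fun u => sw (a u) f).
Proof.
move=> fl fr al c x y; rewrite al !sw_comul comul_linear.
exact: tensor_sum_linear.
Qed.

(** A bilinear summand only sees the tensor [comul h], so any expression of it by pure tensors may
    replace the chosen representative. *)
Lemma sw_tensorP V (f : H -> H -> V) I (r : seq I) (F G : I -> H) h :
  (forall y, linear (f^~ y)) -> (forall x, linear (f x)) ->
  comul h = \sum_(i <- r) tpure (F i) (G i) ->
  sw h f = \sum_(i <- r) f (F i) (G i).
Proof.
move=> fl fr e.
have fb (a : H -> H) (b : H -> H) m n : False -> f (a m) n = f m (b n) by [].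
rewrite sw_comul e (linear_sum_fun (tensor_sum_linear fl fr fb)).
by apply: eq_bigr => i _; rewrite tensor_sum_pure.
Qed.

Lemma linear_antipode U (f : U -> H) :
  linear f -> linear (fun x => antipode (f x)).
Proof. exact/linear_comp/antipode_linear. Qed.

Lemma linear_mull U (f : U -> H) g : linear f -> linear (fun x => f x * g).
Proof. by move=> fl a x y; rewrite fl mulrDl scalerAl. Qed.

Lemma linear_mulr U (f : U -> H) g : linear f -> linear (fun x => g * f x).
Proof. by move=> fl a x y; rewrite fl mulrDr scalerAr. Qed.

Lemma linear_counit U (f : U -> H) V (v : V) :
  linear f -> linear (fun x => counit (f x) *: v).
Proof. by move=> fl; apply/linear_scalel/linear_comp/fl/counit_linear. Qed.

End Sweedler.

(** * Linearity of the operations and its automation *)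

Section TpureLinear.
Variables (k : fieldType) (U M N : lmodType k).
Variable bal : (M -> M) -> (N -> N) -> Prop.

Lemma linear_tpurel (f : U -> M) (n : N) :
  linear f -> linear (fun x => tpure (bal := bal) (f x) n).
Proof.
move=> fl a x y; rewrite fl [a *: tpure _ _]tensor_scaleE [RHS]tensor_addE.
by apply/tensor_piP; apply: tensor_eq_Dl.
Qed.

Lemma linear_tpurer (f : U -> N) (m : M) :
  linear f -> linear (fun x => tpure (bal := bal) m (f x)).
Proof.
move=> fl a x y; rewrite fl [a *: tpure _ _]tensor_scaleE [RHS]tensor_addE.
apply/tensor_piP; apply: tensor_eq_trans (tensor_eq_Dr _ _ _ _) _.
rewrite -cat1s; apply: tensor_eq_cat (tensor_eq_refl _ _).
exact/tensor_eq_sym/tensor_eq_Z.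
Qed.

End TpureLinear.

Section PmaLinear.
Variables (k : fieldType) (H : hopfAlgebra k) (U B : lmodType k).
Variable A : partial_module_algebra H B.

Lemma linear_pma_actl (f : U -> H) b :
  linear f -> linear (fun x => pma_act A (f x) b).
Proof. exact: (linear_comp (pma_act_linearl A b)). Qed.

Lemma linear_pma_actr (f : U -> B) h :
  linear f -> linear (fun x => pma_act A h (f x)).
Proof. exact: (linear_comp (pma_act_linearr A h)). Qed.

Lemma linear_pma_prodl (f : U -> B) b :
  linear f -> linear (fun x => pma_prod A (f x) b).
Proof. exact: (linear_comp (pma_prod_linearl A b)). Qed.

Lemma linear_pma_prodr (f : U -> B) b :
  linear f -> linear (fun x => pma_prod A b (f x)).
Proof. exact: (linear_comp (pma_prod_linearr A b)). Qed.

End PmaLinear.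

Opaque sw.

(** The rules for Sweedler sums ask for linearity in each variable; this search follows the
    structure of the term and uses the linearity assumptions of the context. *)
Ltac lin_step := first
  [ assumption
  | exact: linear_id
  | apply: linear_antipode
  | apply: linear_mull
  | apply: linear_mulr
  | apply: linear_counit
  | apply: linear_scale
  | apply: linear_sw_arg
  | apply: linear_sw
  | apply: linear_tpurel
  | apply: linear_tpurer
  | apply: linear_pma_actl
  | apply: linear_pma_actr
  | apply: linear_pma_prodl
  | apply: linear_pma_prodr
  | match goal with h : forall _, linear _ |- linear _ =>
      refine (linear_comp (h _) _) end
  | match goal with h : forall _ _, linear _ |- linear _ =>
      refine (linear_comp (h _ _) _) end
  | match goal with h : linear _ |- linear _ => refine (linear_comp h _) end ].

Ltac lin := solve [ intros; cbv beta; repeat (lin_step; intros; cbv beta) ].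

(** * Hopf algebra laws as rules for Sweedler sums *)

Section SweedlerCalculus.
Variables (k : fieldType) (H : hopfAlgebra k) (V : lmodType k).
Implicit Types (h : H).

Lemma sw1 (f : H -> H -> V) :
  (forall y, linear (f^~ y)) -> (forall x, linear (f x)) -> sw 1 f = f 1 1.
Proof.
move=> fl fr; rewrite (@sw_tensorP _ _ _ f _ [:: tt] (fun=> 1) (fun=> 1)) //.
  by rewrite big_seq1.
by rewrite big_seq1 comul1.
Qed.

Lemma swM (f : H -> H -> V) g h :
  (forall y, linear (f^~ y)) -> (forall x, linear (f x)) ->
  sw (g * h) f =
  sw g (fun x y => sw h (fun u v => f (x * u) (y * v))).
Proof.
move=> fl fr; have fb (a b : H -> H) m n : False -> f (a m) n = f m (b n) by [].
have tl := tensor_sum_linear fl fr fb.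
rewrite sw_comul comulM (linear_sum_fun tl); apply: eq_bigr => p _.
rewrite (linear_sum_fun tl); apply: eq_bigr => q _.
exact: tensor_sum_pure.
Qed.

(** The trilinear [f] induces a linear map on H ⊗ (H ⊗ H) in two stages, [F2] being the inner one;
    applying it to both sides of [comulA] gives the equation. *)
Lemma swA (f : H -> H -> H -> V) h :
  (forall y z, linear (fun x => f x y z)) ->
  (forall x z, linear (fun y => f x y z)) ->
  (forall x y, linear (f x y)) ->
  sw h (fun x y => sw x (fun u v => f u v y)) =
  sw h (fun x y => sw y (fun u v => f x u v)).
Proof.
move=> f1 f2 f3.
pose F2 a (u : tensor_k H H) := tensor_sum (f a) u.
have nb (M N W : lmodType k) (f0 : M -> N -> W) (a : M -> M) (b : N -> N) m n :
  False -> f0 (a m) n = f0 m (b n) by [].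
have F2l a : linear (F2 a).
  exact: (tensor_sum_linear (f2 a) (f3 a) (@nb _ _ _ _)).
have F2p a m n : F2 a (m ⊗ n) = f a m n.
  exact: (tensor_sum_pure (f2 a) (f3 a) (@nb _ _ _ _)).
have F1l u : linear (F2^~ u) by apply: linear_sum => p.
have tl := tensor_sum_linear F1l F2l (@nb _ _ _ _).
have tp := tensor_sum_pure F1l F2l (@nb _ _ _ _).
have := congr1 (tensor_sum F2) (comulA h).
rewrite !(linear_sum_fun tl).
under eq_bigr do rewrite (linear_sum_fun tl).
under [in RHS]eq_bigr do rewrite (linear_sum_fun tl).
move=> e; apply: etrans (etrans e _).
  by apply: eq_bigr => p _; apply: eq_bigr => q _; rewrite tp F2p.
by apply: eq_bigr => p _; apply: eq_bigr => q _; rewrite tp F2p.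
Qed.

Lemma sw_counitl (f : H -> V) h :
  linear f -> sw h (fun x y => counit x *: f y) = f h.
Proof.
move=> fl; rewrite -[in RHS](counit_comull h) (linear_sum_fun fl).
by apply: eq_bigr => p _; rewrite (linearZ_fun fl).
Qed.

Lemma sw_counitr (f : H -> V) h :
  linear f -> sw h (fun x y => counit y *: f x) = f h.
Proof.
move=> fl; rewrite -[in RHS](counit_comulr h) (linear_sum_fun fl).
by apply: eq_bigr => p _; rewrite (linearZ_fun fl).
Qed.

Lemma sw_antipodel (f : H -> V) h :
  linear f -> sw h (fun x y => f (antipode x * y)) = counit h *: f 1.
Proof.
by move=> fl; rewrite -(linearZ_fun fl) -antipodel (linear_sum_fun fl).
Qed.

Lemma sw_antipoder (f : H -> V) h :
  linear f -> sw h (fun x y => f (x * antipode y)) = counit h *: f 1.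
Proof.
by move=> fl; rewrite -(linearZ_fun fl) -antipoder (linear_sum_fun fl).
Qed.

End SweedlerCalculus.

Section Antipode.
Variables (k : fieldType) (H : hopfAlgebra k) (V : lmodType k).
Implicit Types (g h : H).
Local Notation S := (@antipode k H).

(* Right-nested Sweedler sums: [sw_xSl] reads x_(1) S(x_(2)) ⊗ x_(3) = 1 ⊗ x,
   and the other three lemmas are its variants. *)
Lemma sw_xSl (f : H -> H -> V) h :
  (forall y, linear (f^~ y)) -> (forall x, linear (f x)) ->
  sw h (fun x y => sw y (fun u v => f (x * S u) v)) = f 1 h.
Proof.
move=> fl fr; rewrite -(swA (f := fun x u v => f (x * S u) v)); try by lin.
under eq_sw => x y do rewrite (sw_antipoder (f := f^~ y)) //.
by rewrite (sw_counitl (f := f 1)).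
Qed.

Lemma sw_Sxl (f : H -> H -> V) h :
  (forall y, linear (f^~ y)) -> (forall x, linear (f x)) ->
  sw h (fun x y => sw y (fun u v => f (S x * u) v)) = f 1 h.
Proof.
move=> fl fr; rewrite -(swA (f := fun x u v => f (S x * u) v)); try by lin.
under eq_sw => x y do rewrite (sw_antipodel (f := f^~ y)) //.
by rewrite (sw_counitl (f := f 1)).
Qed.

Lemma sw_xSr (f : H -> H -> V) h :
  (forall y, linear (f^~ y)) -> (forall x, linear (f x)) ->
  sw h (fun x y => sw y (fun u v => f x (u * S v))) = f h 1.
Proof.
move=> fl fr; under eq_sw => x y do rewrite (sw_antipoder (f := f x)) //.
by rewrite (sw_counitr (f := f^~ 1)).
Qed.

Lemma sw_Sxr (f : H -> H -> V) h :
  (forall y, linear (f^~ y)) -> (forall x, linear (f x)) ->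
  sw h (fun x y => sw y (fun u v => f x (S u * v))) = f h 1.
Proof.
move=> fl fr; under eq_sw => x y do rewrite (sw_antipodel (f := f x)) //.
by rewrite (sw_counitr (f := f^~ 1)).
Qed.

End Antipode.

(** * The antipode reverses products and coproducts *)

Section AntipodeMorphism.
Variables (k : fieldType) (H : hopfAlgebra k).
Implicit Types (g h : H).
Local Notation S := (@antipode k H).

Lemma antipode1 : S 1 = 1.
Proof.
have := sw_antipodel (f := id) (1 : H) (@linear_id _ _).
rewrite sw1 ?counit1 ?scale1r ?mulr1 //; lin.
Qed.

(* Both sides are the convolution inverse of the multiplication. *)
Lemma antipodeM g h : S (g * h) = S h * S g.
Proof.
(* [Y] is the sum of S(h1) S(g1) g2 h2 S(g3 h3): cancelling from the left leaves S(g h), cancelling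
   from the right leaves S(h) S(g). *)
pose Y := sw g (fun a x => sw h (fun d y =>
  S d * (S a * sw (x * y) (fun p q => p * S q)))).
transitivity Y.
  pose F p c := sw h (fun d y => sw y (fun u v => S d * (p * u * S (c * v)))).
  transitivity (F 1 g).
    rewrite /F; under eq_sw => a x do under eq_sw => b c do rewrite mul1r mulrA.
    by rewrite (sw_Sxl (f := fun p v => p * S (g * v))) ?mul1r //; lin.
  rewrite -(sw_Sxl (f := F)); try by rewrite /F; lin.
  apply: eq_sw => a x; rewrite exchange_sw; apply: eq_sw => d y.
  rewrite swM; try by lin.
  rewrite (raddf_sw (a := fun z => S d * (S a * z))); last by lin.
  apply: eq_sw => b c.
  rewrite (raddf_sw (a := fun z => S d * (S a * z))); last by lin.
  by apply: eq_sw => u v; rewrite !mulrA.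
rewrite -(sw_counitr (f := fun a => S h * S a) g); last by lin.
apply: eq_sw => a x.
rewrite -(sw_counitr (f := fun d => S d * S a) h); last by lin.
rewrite (raddf_sw (a := fun z => counit x *: z)); last by lin.
apply: eq_sw => d y.
rewrite (sw_antipoder (f := id)) // counitM -scalerA.
by rewrite -!scalerAr mulr1.
Qed.

(* Both sides are the convolution inverse of the comultiplication. *)
Lemma sw_antipode (V : lmodType k) (f : H -> H -> V) h :
  (forall y, linear (f^~ y)) -> (forall x, linear (f x)) ->
  sw (S h) f = sw h (fun x y => f (S y) (S x)).
Proof.
move=> fl fr.
(* Y is the sum of f (S(h1)_1 h2 S(h5)) (S(h1)_2 h3 S(h4)). *)
pose Y := sw h (fun x y => sw y (fun u v => sw (S x) (fun p q =>
  sw u (fun r s => sw v (fun w z => f (p * (r * S z)) (q * (s * S w))))))).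
transitivity Y.
  rewrite /Y.
  have F y p q : sw y (fun u v => sw u (fun r s => sw v (fun w z =>
       f (p * (r * S z)) (q * (s * S w))))) = counit y *: f p q.
    rewrite (swA (f := fun r s v => sw v (fun w z =>
       f (p * (r * S z)) (q * (s * S w))))); try by lin.
    under eq_sw => r v.
      rewrite (sw_xSl (f := fun a z => f (p * (r * S z)) (q * a))); try by lin.
      over.
    rewrite (sw_antipoder (f := fun a => f (p * a) (q * 1))); last by lin.
    by rewrite !mulr1.
  under [RHS]eq_sw => x y do rewrite exchange_sw.
  under [RHS]eq_sw => x y.
    under eq_sw => p q do rewrite F.
    rewrite -(raddf_sw (a := fun z => counit y *: z)); last by lin.
    over.
  by rewrite (sw_counitr (f := fun x => sw (S x) f)) //; lin.
(* [G 1 h] is the right side; replacing 1 ⊗ h by S(h1) h2 ⊗ h3 and comultiplying the product S(h1)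
   h2 turns it into [Y]. *)
pose G a v := sw a (fun p q => sw v (fun w z => f (p * S z) (q * S w))).
transitivity (G 1 h); last first.
  by rewrite /G sw1; [apply: eq_sw => x y; rewrite !mul1r | lin | lin].
rewrite -(sw_Sxl (f := G)); last 2 first; try by rewrite /G; lin.
apply: eq_sw => x y; apply: eq_sw => u v.
rewrite /G swM; try by lin.
apply: eq_sw => p q; apply: eq_sw => r s; apply: eq_sw => w z.
by rewrite !mulrA.
Qed.

End AntipodeMorphism.

(** * The inverse antipode and the coopposite Hopf algebra *)

Section AntipodeInverse.
Variables (k : fieldType) (H : hopfAlgebra k).
Hypothesis bijS : bijective (@antipode k H).
Local Notation S := (@antipode k H).
Local Notation T := (@antipode_inv k H).

Lemma antipode_invK : cancel T S.
Proof.
have [S' SK S'K] := bijS.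
by move=> h; rewrite /antipode_inv; case: xgetP => // /(_ (S' h)) /(_ (S'K h)).
Qed.

Lemma antipodeK : cancel S T.
Proof. by move=> h; apply: (bij_inj bijS); rewrite antipode_invK. Qed.

Lemma antipode_inv_linear : linear T.
Proof.
move=> a x y; apply: (bij_inj bijS).
by rewrite antipode_linear !antipode_invK.
Qed.

End AntipodeInverse.

Section Coopposite.
Variables (k : fieldType) (H : hopfAlgebra k).
Hypothesis bijS : bijective (@antipode k H).
Local Notation S := (@antipode k H).
Local Notation T := (@antipode_inv k H).
Let Tl : linear T := antipode_inv_linear bijS.
Implicit Types (V : lmodType k) (g h : H).

Definition cop_comul h : tensor_k H H := sw h (fun x y => tpure y x).

(** This is [sw] for the coopposite Hopf algebra, available before that structure exists; the laws
    below are convertible to the fields that [cop] needs. *)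
Let swc V h (f : H -> H -> V) : V := tensor_sum f (cop_comul h).

Let swcE V h (f : H -> H -> V) :
  (forall y, linear (f^~ y)) -> (forall x, linear (f x)) ->
  swc h f = sw h (fun x y => f y x).
Proof.
move=> fl fr; have fb (a b : H -> H) m n : False -> f (a m) n = f m (b n) by [].
rewrite /swc (raddf_sw _ _ (tensor_sum_linear fl fr fb)).
by apply: eq_sw => x y; rewrite tensor_sum_pure.
Qed.

Fact cop_comul_linear : linear cop_comul.
Proof. rewrite /cop_comul; lin. Qed.

Let eq_swc V h (f f' : H -> H -> V) :
  (forall x y, f x y = f' x y) -> swc h f = swc h f'.
Proof. by move=> e; apply: eq_bigr. Qed.

Fact cop_comulA h :
  swc h (fun a b => swc a (fun u v =>
    tpure u (tpure v b : tensor_k H H) : tensor_k H (tensor_k H H))) =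
  swc h (fun a b => swc b (fun u v => tpure a (tpure u v))).
Proof.
under eq_swc => a b do (rewrite swcE; [|lin|lin]).
under [RHS]eq_swc => a b do (rewrite swcE; [|lin|lin]).
rewrite !swcE; try by lin.
by rewrite -(swA (f := fun u v b => tpure b (tpure v u))) //; lin.
Qed.

Fact cop_counitl h : swc h (fun x y => counit x *: y) = h.
Proof.
by rewrite swcE; [rewrite (sw_counitr (f := id)) | lin | lin].
Qed.

Fact cop_counitr h : swc h (fun x y => counit y *: x) = h.
Proof.
by rewrite swcE; [rewrite (sw_counitl (f := id)) | lin | lin].
Qed.

Fact cop_comul1 : cop_comul 1 = tpure 1 1.
Proof. by rewrite /cop_comul sw1 //; lin. Qed.

Fact cop_comulM g h : cop_comul (g * h) =
  swc g (fun x y => swc h (fun u v => tpure (x * u) (y * v))).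
Proof.
under eq_swc => a b do (rewrite swcE; [|lin|lin]).
rewrite swcE; try by lin.
by rewrite /cop_comul swM //; lin.
Qed.

(** [S] is injective and reverses products, so applying it to T(h2) h1 reduces the claim to the law
    for S(h1) h2. *)
Fact cop_antipodel h : swc h (fun x y => T x * y) = counit h *: 1.
Proof.
rewrite swcE; try by lin.
apply: (bij_inj bijS); rewrite (linearZ_fun (@antipode_linear _ _)) antipode1.
rewrite (raddf_sw _ _ (@antipode_linear _ _)).
under eq_sw => x y do rewrite antipodeM antipode_invK //.
by rewrite (sw_antipodel (f := id)).
Qed.

Fact cop_antipoder h : swc h (fun x y => x * T y) = counit h *: 1.
Proof.
rewrite swcE; try by lin.
apply: (bij_inj bijS); rewrite (linearZ_fun (@antipode_linear _ _)) antipode1.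
rewrite (raddf_sw _ _ (@antipode_linear _ _)).
under eq_sw => x y do rewrite antipodeM antipode_invK //.
by rewrite (sw_antipoder (f := id)).
Qed.

Definition cop : hopfAlgebra k :=
  HopfAlgebra cop_comul_linear (@counit_linear k H) Tl cop_comulA
    cop_counitl cop_counitr cop_comul1 cop_comulM (@counit1 k H)
    (@counitM k H) cop_antipodel cop_antipoder.

Lemma sw_cop V h (f : H -> H -> V) :
  (forall y, linear (f^~ y)) -> (forall x, linear (f x)) ->
  sw (H := cop) h f = sw h (fun x y => f y x).
Proof. exact: swcE. Qed.

End Coopposite.

Section MiddleCancellation.
Variables (k : fieldType) (H : hopfAlgebra k) (V : lmodType k).
Local Notation S := (@antipode k H).

(** This reads h1 ⊗ h2 S(h3) ⊗ h4 = h1 ⊗ 1 ⊗ h2, bracketed as it arises when h1 • (S(h2) • (a b)) is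
    expanded over the product. *)
Lemma sw_midS (f : H -> H -> H -> V) h :
  (forall y z, linear (fun x => f x y z)) ->
  (forall x z, linear (fun y => f x y z)) ->
  (forall x y, linear (f x y)) ->
  sw h (fun x y => sw y (fun p q => sw x (fun r s => f r (s * S p) q))) =
  sw h (fun x y => f x 1 y).
Proof.
move=> f1 f2 f3.
under eq_sw => x y do rewrite exchange_sw.
rewrite (swA (f := fun r s y => sw y (fun p q => f r (s * S p) q))); try by lin.
by apply: eq_sw => r z; rewrite (sw_xSl (f := f r)).
Qed.

End MiddleCancellation.

(** * The partial module axioms and their mirror forms *)

Section PartialModuleAxioms.
Variables (k : fieldType) (H : hopfAlgebra k) (B : lmodType k).
Variable act : H -> B -> B.
Local Notation S := (@antipode k H).
Local Notation "h • m" := (act h m) (at level 35, right associativity).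

(** The axioms are stated at one element, so that they can be proved first at products. *)
Definition pactMl_at (m : B) := forall h g,
  sw g (fun x y => h • x • S y • m) = sw g (fun x y => (h * x) • S y • m).

Definition pactMr_at (m : B) := forall h g,
  sw h (fun x y => x • S y • g • m) = sw h (fun x y => x • (S y * g) • m).

Hypothesis actl : forall m, linear (act^~ m).
Hypothesis actr : forall h, linear (act h).
Hypothesis act1 : forall m, 1 • m = m.
Hypothesis actSl : forall h g m,
  sw g (fun x y => h • S x • y • m) = sw g (fun x y => (h * S x) • y • m).
Hypothesis actSr : forall h g m,
  sw h (fun x y => S x • y • g • m) = sw h (fun x y => S x • (y * g) • m).

(** Both sides equal the sum of (h g1 S(g2)) • g3 • S(g4) • m: the left one because g1 S(g2) ⊗ g3 =
    1 ⊗ g, the right one by S(z) • m = S(z1) • z2 • S(z3) • m and [actSl]. *)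
Lemma pactMl_from_antipode m : pactMl_at m.
Proof.
move=> h g.
have SxS z : sw z (fun a w => sw w (fun b c => S a • b • S c • m)) = S z • m.
  rewrite -(swA (f := fun a b c => S a • b • S c • m)); try by lin.
  under eq_sw => x y do rewrite actSr.
  rewrite (swA (f := fun a b c => S a • (b * S c) • m)); try by lin.
  by rewrite (sw_xSr (f := fun a b => S a • b • m)) ?act1 //; lin.
pose F p v := (h * p) • sw v (fun b c => b • S c • m).
transitivity (F 1 g); first by rewrite /F mulr1 (raddf_sw _ _ (actr h)).
rewrite -(sw_xSl (f := F)); try by rewrite /F; lin.
apply: eq_sw => x y; rewrite -SxS (raddf_sw _ _ (actr _)) /F.
under [RHS]eq_sw => a w do rewrite (raddf_sw _ _ (actr _)).
under [LHS]eq_sw => a w do rewrite (raddf_sw _ _ (actr _)) mulrA.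
rewrite -(swA (f := fun a b c => (h * x * S a) • b • S c • m)); try by lin.
under eq_sw => u c do rewrite -actSl.
by rewrite (swA (f := fun a b c => (h * x) • S a • b • S c • m)) //; lin.
Qed.

(** Both sides equal the sum of h1 • S(h2) • (h3 S(h4) g) • m: the left one because h1 ⊗ h2 S(h3) =
    h ⊗ 1, the right one by x • n = x1 • S(x2) • x3 • n and [actSr]. *)
Lemma pactMr_from_antipode m : pactMr_at m.
Proof.
move=> h g.
have xSx x n : sw x (fun c z => sw z (fun d q => c • S d • q • n)) = x • n.
  under eq_sw => c z do rewrite actSl.
  by rewrite (sw_xSl (f := fun c q => c • q • n)) ?act1 //; lin.
pose F p q := sw p (fun c d => c • S d • (q * g) • m).
transitivity (F h 1); first by rewrite /F mul1r.
rewrite -(sw_xSr (f := F)); try by rewrite /F; lin.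
rewrite -(swA (f := fun x u v => F x (u * S v))); try by rewrite /F; lin.
apply: eq_sw => x y; rewrite -xSx /F.
rewrite (swA (f := fun c d q => c • S d • (q * S y * g) • m)); try by lin.
apply: eq_sw => c z; rewrite -!(raddf_sw _ _ (actr c)) actSr.
by congr (c • _); apply: eq_sw => d q; rewrite mulrA.
Qed.

End PartialModuleAxioms.

(** * Products in a symmetrical partial module algebra *)

Section SymmetricalPartialActions.
Variables (k : fieldType) (H : hopfAlgebra k) (B : lmodType k).
Variable A : partial_module_algebra H B.
Hypothesis symA : symmetrical A.
Implicit Types (g h : H) (a b m : B).
Local Notation S := (@antipode k H).
Local Notation "h • m" := (pma_act A h m) (at level 35, right associativity).
Local Notation "a ★ b" := (pma_prod A a b) (at level 38, left associativity).

Lemma act_mul_act h g a b :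
  h • (a ★ (g • b)) = sw h (fun x y => (x • a) ★ ((y * g) • b)).
Proof. exact: pma_actM. Qed.

Lemma act_act_mul h g a b :
  h • ((g • b) ★ a) = sw h (fun x y => ((x * g) • b) ★ (y • a)).
Proof. exact: symA. Qed.

Lemma act_mul h a b : h • (a ★ b) = sw h (fun x y => (x • a) ★ (y • b)).
Proof.
rewrite -{1}(pma_act1 A b) act_mul_act.
by apply: eq_sw => x y; rewrite mulr1.
Qed.

Lemma mul_act h a b :
  (h • a) ★ b = sw h (fun x y => x • (a ★ (S y • b))).
Proof.
under eq_sw => x y do rewrite act_mul_act.
rewrite (swA (f := fun p q y => (p • a) ★ ((q * S y) • b))); try by lin.
by rewrite (sw_xSr (f := fun p q => (p • a) ★ (q • b))) ?pma_act1 //; lin.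
Qed.

(** Once both actions are expanded over the product, b carries h2 g2 S(g3), where g2 S(g3) cancels.
    For h = 1 this says that ε_g acts on a product through its left factor. *)
Lemma act_eps_mul g h a b :
  sw g (fun x y => (h * x) • S y • (a ★ b)) =
  sw h (fun u v => sw g (fun x y => (u * x) • S y • a) ★ (v • b)).
Proof.
transitivity (sw h (fun u v => sw g (fun x y => sw y (fun p q => sw x (fun r s =>
    ((u * r) • S q • a) ★ ((v * (s * S p)) • b)))))).
  rewrite exchange_sw; apply: eq_sw => x y.
  rewrite act_mul sw_antipode; try by lin.
  rewrite (raddf_sw _ _ (pma_act_linearr A _)) exchange_sw.
  apply: eq_sw => p q.
  rewrite act_mul_act swM; try by lin.
  by do 2! apply: eq_sw => ? ?; rewrite ?mulrA.
apply: eq_sw => u v.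
rewrite (sw_midS (f := fun r s q =>
  ((u * r) • S q • a) ★ ((v * s) • b))); try by lin.
rewrite mulr1 (raddf_sw (a := fun z => z ★ (v • b))) //; lin.
Qed.

Lemma eps_mul g a b :
  sw g (fun x y => x • S y • (a ★ b)) = sw g (fun x y => x • S y • a) ★ b.
Proof.
have := act_eps_mul g 1 a b.
rewrite sw1; [|by lin|by lin].
rewrite pma_act1; under eq_sw => x y do rewrite mul1r.
by under [in RHS]eq_sw => x y do rewrite mul1r.
Qed.

(** Since ε_g (a b) = (ε_g a) b is a sum of products with left factor g1 • n, symmetry expands the
    action of h on it into the right side of [act_eps_mul]. *)
Lemma pactMl_mul a b : pactMl_at (pma_act A) (a ★ b).
Proof.
move=> h g; rewrite act_eps_mul.
rewrite -(raddf_sw _ _ (pma_act_linearr A h)) eps_mul.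
rewrite (raddf_sw (a := fun z => h • (z ★ b))); last by lin.
under eq_sw => x y do rewrite act_act_mul.
rewrite exchange_sw; apply: eq_sw => u v.
by rewrite (raddf_sw (a := fun z => z ★ (v • b))) //; lin.
Qed.

(** Both sides reduce to the sum of (h1 • (S(h2) g1) • a) (g2 • b): after expansion, the components
    of h that reach b have the form h2 S(h3) and cancel. *)
Lemma pactMr_mul a b : pactMr_at (pma_act A) (a ★ b).
Proof.
move=> h g.
transitivity (sw g (fun u v => sw h (fun x y => (x • (S y * u) • a) ★ (v • b)))).
  under eq_sw => x y do rewrite act_mul (raddf_sw _ _ (pma_act_linearr A _))
    (raddf_sw _ _ (pma_act_linearr A _)).
  rewrite exchange_sw; apply: eq_sw => u v.
  rewrite -[in RHS](pma_act1 A (v • b)).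
  rewrite -(sw_midS (f := fun r s q =>
    (r • (S q * u) • a) ★ (s • v • b))); try by lin.
  apply: eq_sw => x y.
  rewrite act_act_mul sw_antipode; try by lin.
  rewrite (raddf_sw _ _ (pma_act_linearr A _)).
  by apply: eq_sw => p q; rewrite act_mul_act.
transitivity (sw g (fun u v => sw h (fun x y => sw y (fun p q =>
    x • (((S q * u) • a) ★ ((S p * v) • b)))))).
  apply: eq_sw => u v.
  rewrite -[in LHS](mul1r v).
  rewrite -(sw_midS (f := fun r s q =>
    (r • (S q * u) • a) ★ ((s * v) • b))); try by lin.
  apply: eq_sw => x y; apply: eq_sw => p q.
  by rewrite act_mul_act; apply: eq_sw => r s; rewrite mulrA.
rewrite exchange_sw; apply: eq_sw => x y.
rewrite act_mul swM; try by lin.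
rewrite sw_antipode; try by lin.
rewrite (raddf_sw _ _ (pma_act_linearr A _)) exchange_sw.
apply: eq_sw => p q.
by rewrite (raddf_sw _ _ (pma_act_linearr A _)).
Qed.

(* The next two lemmas say that the defect of each axiom at m, multiplied on
   the right by b, is a sum of defects at products, hence vanishes. *)
Lemma pactMl_mulr h g m b :
  sw g (fun x y => h • x • S y • m) ★ b =
  sw g (fun x y => (h * x) • S y • m) ★ b.
Proof.
transitivity (sw h (fun u v => sw g (fun x y =>
  u • x • S y • (m ★ (S v • b))))).
  rewrite -(raddf_sw _ _ (pma_act_linearr A h)) mul_act.
  by apply: eq_sw => u v; rewrite -eps_mul (raddf_sw _ _ (pma_act_linearr A u)).
(* The axiom is now used at the product of m and S(h2) • b. *)
under eq_sw => u v do rewrite pactMl_mul.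
rewrite (raddf_sw (a := fun z => z ★ b)); last by lin.
under [RHS]eq_sw => x y do rewrite mul_act.
under [RHS]eq_sw => x y do (rewrite swM; [|lin|lin]).
rewrite [RHS]exchange_sw; apply: eq_sw => u v.
rewrite [RHS](swA (f := fun r s y =>
  (u * r) • ((S y • m) ★ (S (v * s) • b)))); try by lin.
apply: eq_sw => r z.
rewrite act_mul_act sw_antipode; try by lin.
rewrite (raddf_sw _ _ (pma_act_linearr A _)).
by apply: eq_sw => s y; rewrite antipodeM.
Qed.

Lemma pactMr_mulr h g m b :
  sw h (fun x y => x • S y • g • m) ★ b =
  sw h (fun x y => x • (S y * g) • m) ★ b.
Proof.
transitivity (sw g (fun u v => sw h (fun x y =>
  x • S y • u • (m ★ (S v • b))))).
  rewrite -eps_mul exchange_sw; apply: eq_sw => x y.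
  rewrite mul_act (raddf_sw (a := fun z => x • S y • z)) //; lin.
under eq_sw => u v do rewrite pactMr_mul.
rewrite (raddf_sw (a := fun z => z ★ b)); last by lin.
under [RHS]eq_sw => x y do rewrite mul_act.
rewrite [RHS](swA (f := fun r s y =>
  r • (((S y * g) • m) ★ (S s • b)))); try by lin.
rewrite exchange_sw; apply: eq_sw => r z.
rewrite -!(raddf_sw _ _ (pma_act_linearr A r)); congr (r • _).
under eq_sw => u v do (rewrite act_mul_act swM; [|lin|lin]).
rewrite exchange_sw sw_antipode; try by lin.
apply: eq_sw => s y.
rewrite (swA (f := fun p q v =>
  ((S y * p) • m) ★ ((S s * q * S v) • b))); try by lin.
under eq_sw => u v do under eq_sw => p q do rewrite -mulrA.
by rewrite (sw_xSr (f := fun p q =>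
  ((S y * p) • m) ★ ((S s * q) • b))) ?mulr1 //; lin.
Qed.

End SymmetricalPartialActions.

(** * From products to all elements, and the opposite algebra *)

Section PartialModuleOfAlgebra.
Variables (k : fieldType) (H : hopfAlgebra k) (B : lmodType k).
Variable A : partial_module_algebra H B.
Hypothesis symA : symmetrical A.
Local Notation S := (@antipode k H).

Lemma pactM_left_annihilator :
  left_annihilator (pma_prod A) = [set 0]%classic ->
  forall m, pactMl_at (pma_act A) m /\ pactMr_at (pma_act A) m.
Proof.
move=> l0 m.
have mul_inj u v : (forall b, pma_prod A u b = pma_prod A v b) -> u = v.
  move=> e; apply/eqP; rewrite -subr_eq0; apply/eqP.
  have : left_annihilator (pma_prod A) (u - v).
    move=> b; rewrite -scaleN1r addrC (pma_prod_linearl A b) e.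
    by rewrite scaleN1r addNr.
  by rewrite l0.
by split=> h g; apply: mul_inj => b; [apply: pactMl_mulr | apply: pactMr_mulr].
Qed.

(** Both sides of each axiom are linear in m, so the case of products extends to sums of
    products. *)
Lemma pactM_idempotent :
  idempotent_prod (pma_prod A) ->
  forall m, pactMl_at (pma_act A) m /\ pactMr_at (pma_act A) m.
Proof.
move=> idem m; have [s ->] := idem m.
split=> h g.
  pose L n := sw g (fun x y =>
    pma_act A h (pma_act A x (pma_act A (S y) n))).
  pose R n := sw g (fun x y => pma_act A (h * x) (pma_act A (S y) n)).
  have Ll : linear L by rewrite /L; lin.
  have Rl : linear R by rewrite /R; lin.
  rewrite -/(L _) -/(R _) !linear_sum_fun //.
  by apply: eq_bigr => p _; apply: pactMl_mul.
pose L n := sw h (fun x y =>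
  pma_act A x (pma_act A (S y) (pma_act A g n))).
pose R n := sw h (fun x y => pma_act A x (pma_act A (S y * g) n)).
have Ll : linear L by rewrite /L; lin.
have Rl : linear R by rewrite /R; lin.
rewrite -/(L _) -/(R _) !linear_sum_fun //.
by apply: eq_bigr => p _; apply: pactMr_mul.
Qed.

Hypothesis bijS : bijective S.
Local Notation T := (@antipode_inv k H).

Fact pma_op_actM h g a b :
  pma_act A h (pma_prod A (pma_act A g b) a) =
  sw (H := cop bijS) h (fun x y =>
    pma_prod A (pma_act A ((y : H) * (g : H)) b) (pma_act A x a)).
Proof. by rewrite (act_act_mul symA) sw_cop //; lin. Qed.

(** The action map is kept and the product reversed: this exchanges the axiom of a partial action
    with symmetry, and left with right annihilators. *)
Definition pma_op : partial_module_algebra (cop bijS) B :=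
  @PartialModuleAlgebra k (cop bijS) B (fun a b => pma_prod A b a)
    (pma_prod_linearr A) (pma_prod_linearl A)
    (fun a b c => esym (pma_prodA A c b a))
    (pma_act A) (pma_act_linearl A) (pma_act_linearr A) (pma_act1 A)
    pma_op_actM.

Lemma symmetrical_op : symmetrical pma_op.
Proof.
move=> h g a b; rewrite [LHS](act_mul_act A).
by rewrite -[RHS]/(sw (H := cop bijS) h (fun x y =>
  pma_prod A (pma_act A y a) (pma_act A ((x : H) * (g : H)) b)))
  sw_cop //; lin.
Qed.

End PartialModuleOfAlgebra.

(** * From symmetrical partial actions to algebras of partial modules *)

Section AlgebraOfPartialModules.
Variables (k : fieldType) (H : hopfAlgebra k) (B : lmodType k).
Variable A : partial_module_algebra H B.
Hypothesis symA : symmetrical A.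
Hypothesis bijS : bijective (@antipode k H).
Local Notation S := (@antipode k H).
Local Notation T := (@antipode_inv k H).
Local Notation "h • m" := (pma_act A h m) (at level 35, right associativity).
Local Notation "a ★ b" := (pma_prod A a b) (at level 38, left associativity).
Let Tl : linear T := antipode_inv_linear bijS.

Lemma pactM_right_annihilator :
  right_annihilator (pma_prod A) = [set 0]%classic ->
  forall m, pactMl_at (pma_act A) m /\ pactMr_at (pma_act A) m.
Proof.
move=> r0.
(* [r0] is, by conversion, the vanishing of the left annihilator of the opposite product. *)
have op m := pactM_left_annihilator (symmetrical_op symA (bijS := bijS)) r0 m.
have act_S h g m :
    sw g (fun x y => h • S x • y • m) = sw g (fun x y => (h * S x) • y • m).
  (* The antipode of [cop] is T, so the axiom over [cop] involves h • z2 • T(z1) • m; at z = S(g)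
     this is h • S(g1) • g2 • m. *)
  have [/(_ h (S g)) e _] := op m; move: e.
  rewrite !sw_cop; try by lin.
  rewrite !sw_antipode; try by rewrite /=; lin.
  move=> e; apply: etrans (etrans e _); apply: eq_sw => x y /=;
  by rewrite (antipodeK bijS).
have S_act h g m :
    sw h (fun x y => S x • y • g • m) = sw h (fun x y => S x • (y * g) • m).
  have [_ /(_ (S h) g) e] := op m; move: e.
  rewrite !sw_cop; try by lin.
  rewrite !sw_antipode; try by rewrite /=; lin.
  move=> e; apply: etrans (etrans e _); apply: eq_sw => x y /=;
  by rewrite (antipodeK bijS).
move=> m; split.
  exact: (pactMl_from_antipode (pma_act_linearl A) (pma_act_linearr A) (pma_act1 A)).
exact: (pactMr_from_antipode (pma_act_linearl A) (pma_act_linearr A) (pma_act1 A)).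
Qed.

Hypothesis admA : admissible_prod (pma_prod A).

Lemma pactM_admissible m :
  pactMl_at (pma_act A) m /\ pactMr_at (pma_act A) m.
Proof.
by case: admA => [/pactM_idempotent|/pactM_right_annihilator
  |/pactM_left_annihilator]; apply.
Qed.

Definition pma_module : partial_module H B :=
  PartialModule (pma_act_linearl A) (pma_act_linearr A) (pma_act1 A)
    (fun h g m => (pactM_admissible m).1 h g)
    (fun h g m => (pactM_admissible m).2 h g).

(** By [mul_act] the left side is the sum of h2 • ((T(h1) • a) (S(h3) • m)), and z2 • ((T(z1) • a)
    n) = a (z • n) because z2 T(z1) cancels, by the antipode law of [cop]. *)
Lemma mul_eps h a m :
  sw h (fun x y => y • T x • a) ★ m = a ★ sw h (fun x y => x • S y • m).
Proof.
have mulT z n : sw z (fun x y => y • ((T x • a) ★ n)) = a ★ (z • n).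
  under eq_sw => x y do rewrite (act_act_mul symA).
  rewrite -(swA (f := fun x p q => ((p * T x) • a) ★ (q • n))); try by lin.
  have E y q : sw y (fun x p => ((p * T x) • a) ★ (q • n)) =
      counit y *: (a ★ (q • n)).
    rewrite -[in RHS](pma_act1 A a).
    rewrite -(sw_antipoder (H := cop bijS)
      (f := fun p => (p • a) ★ (q • n)) y); last by lin.
    by rewrite sw_cop //; lin.
  under eq_sw => y q do rewrite E.
  by rewrite (sw_counitl (f := fun q => a ★ (q • n))) //; lin.
rewrite (raddf_sw (a := fun z => z ★ m)); last by lin.
under eq_sw => x y do rewrite mul_act.
rewrite -(swA (f := fun x y w => y • ((T x • a) ★ (S w • m)))); try by lin.
rewrite (raddf_sw _ _ (pma_prod_linearr A a)).
by apply: eq_sw => z w; rewrite mulT.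
Qed.

Lemma hpar_act_eps (M : lmodType k) (P : partial_module H M) h m :
  hpar_act P (hpar_eps h) m = sw h (fun x y => P x (P (S y) m)).
Proof.
rewrite /hpar_eps (linear_sum_fun (hpar_act_linearl P m)).
by apply: eq_bigr => p _; rewrite hpar_actM !hpar_act_gen.
Qed.

(** Right actions of A_par are built from those of the generators ε_h, for which this is
    [mul_eps]. *)
Lemma mul_balanced (c : Hpar H) (f : B -> B) (a b : B) :
  Apar_ract pma_module c f -> f a ★ b = a ★ hpar_act pma_module c b.
Proof.
move=> r; elim: r a b => {c f} [h||c x y f g _ IHf _ IHg|x y f g _ IHf _ IHg] a b.
- by rewrite hpar_act_eps; apply: mul_eps.
- by rewrite hpar_act1.
- rewrite (hpar_act_linearl _ _ c x y) (pma_prod_linearr A) -IHf -IHg.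
  exact: pma_prod_linearl.
- by rewrite hpar_actM -IHf -IHg.
Qed.

Definition pma_tensor_mul : tensor_Apar pma_module pma_module -> B :=
  tensor_sum (pma_prod A).

Let bal f g (m n : B) :
  (exists2 c, Apar_ract pma_module c f & g = hpar_act pma_module c) ->
  f m ★ n = m ★ g n.
Proof. by move=> [c r ->]; apply: mul_balanced. Qed.

Fact pma_tensor_mul_linear : linear pma_tensor_mul.
Proof. exact: (tensor_sum_linear (pma_prod_linearl A) (pma_prod_linearr A)). Qed.

Fact pma_tensor_mul_pure a b : pma_tensor_mul (tpure a b) = a ★ b.
Proof. exact: (tensor_sum_pure (pma_prod_linearl A) (pma_prod_linearr A)). Qed.

Fact pma_tensor_mulA a b c :
  pma_tensor_mul (tpure (pma_tensor_mul (tpure a b)) c) =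
  pma_tensor_mul (tpure a (pma_tensor_mul (tpure b c))).
Proof. by rewrite !pma_tensor_mul_pure pma_prodA. Qed.

Fact pma_tensor_mul_morph h a b :
  pma_module h (pma_tensor_mul (tpure a b)) =
  pma_tensor_mul
    (\sum_(p <- sweedler h) tpure (pma_module p.1 a) (pma_module p.2 b)).
Proof.
rewrite (linear_sum_fun pma_tensor_mul_linear) pma_tensor_mul_pure.
rewrite [LHS]act_mul; apply: eq_bigr => p _.
by rewrite pma_tensor_mul_pure.
Qed.

Definition par_algebra_of_pma : par_algebra H B :=
  ParAlgebra pma_tensor_mul_linear pma_tensor_mulA pma_tensor_mul_morph.

End AlgebraOfPartialModules.

(** * From algebras of partial modules to symmetrical partial actions *)

Section PartialActionOfAlgebra.
Variables (k : fieldType) (H : hopfAlgebra k) (B : lmodType k).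
Hypothesis bijS : bijective (@antipode k H).
Local Notation S := (@antipode k H).
Local Notation T := (@antipode_inv k H).
Let Tl : linear T := antipode_inv_linear bijS.

Section Module.
Variable P : partial_module H B.
Let Pl m : linear (P^~ m) := pact_linearl P m.
Let Pr h : linear (P h) := pact_linearr P h.
Local Notation "h • m" := (P h m) (at level 35, right associativity).

(** The second module axiom turns the sum into h1 • (S(h2) h3 g) • m, where S(h2) h3 cancels. *)
Lemma eps_act g h m :
  sw h (fun x y => sw x (fun c d => c • S d • (y * g) • m)) = h • g • m.
Proof.
have prMr x n : sw x (fun c d => c • S d • n • m) =
    sw x (fun c d => c • (S d * n) • m).
  exact: pactMr.
under eq_sw => x y do rewrite prMr.
rewrite (swA (f := fun c d y => c • (S d * (y * g)) • m)); try by lin.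
under eq_sw => c z do under eq_sw => d y do rewrite mulrA.
by rewrite (sw_Sxr (f := fun c d => c • (d * g) • m)) ?mul1r //; lin.
Qed.

(** With h = S(t) the left side is the sum of S(t1) • t2 • (S(t3) g) • m; the two module axioms turn
    it into (S(t1) t2) • S(t3) • g • m, where S(t1) t2 cancels. *)
Lemma act_eps g h m :
  sw h (fun x y => sw y (fun c d => d • T c • (x * g) • m)) = h • g • m.
Proof.
rewrite -(antipode_invK bijS h); move: (T h) => t.
rewrite sw_antipode; try by lin.
under eq_sw => x y do (rewrite sw_antipode; [|lin|lin]).
under eq_sw => x y do under eq_sw => c d do rewrite (antipodeK bijS).
rewrite (swA (f := fun p q x => S p • q • (S x * g) • m)); try by lin.
have prM p z : sw z (fun q x => S p • q • (S x * g) • m) =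
    sw z (fun q x => (S p * q) • S x • g • m).
  rewrite -(raddf_sw _ _ (Pr (S p))).
  transitivity (S p • sw z (fun q x => q • S x • g • m)).
    by congr (P _ _); apply/esym/pactMr.
  by rewrite (raddf_sw _ _ (Pr (S p))); apply: pactMl.
under eq_sw => p z do rewrite prM.
by rewrite (sw_Sxl (f := fun q x => q • S x • g • m)) ?pact1 //; lin.
Qed.

End Module.

Variable A : par_algebra H B.
Let Al m : linear (A^~ m) := pact_linearl A m.
Let Ar h : linear (A h) := pact_linearr A h.
Local Notation "h • m" := (pa_module A h m) (at level 35, right associativity).
Local Notation "a ★ b" := (pa_prod A a b) (at level 38, left associativity).

Lemma pa_prod_linearl b : linear (pa_prod A ^~ b).
Proof. by apply: (linear_comp (@pa_mul_linear _ _ _ A)); apply: linear_tpurel. Qed.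

Lemma pa_prod_linearr a : linear (pa_prod A a).
Proof. by apply: (linear_comp (@pa_mul_linear _ _ _ A)); apply: linear_tpurer. Qed.

Let Ml := pa_prod_linearl.
Let Mr := pa_prod_linearr.

Lemma pa_prodA : associative (pa_prod A).
Proof. by move=> a b c; rewrite /pa_prod pa_mulA. Qed.

Lemma pa_prod_eps h a b :
  sw h (fun x y => y • T x • a) ★ b = a ★ sw h (fun x y => x • S y • b).
Proof.
rewrite -hpar_act_eps /pa_prod; congr (pa_mul _).
apply/tensor_piP; apply: (@tensor_eq_bal _ _ _ _
  (fun m => sw h (fun x y => y • T x • m)) (hpar_act A (hpar_eps h))).
by exists (hpar_eps h) => //; apply: Apar_ract_eps.
Qed.

Lemma act_pa_prod h a b :
  h • (a ★ b) = sw h (fun x y => (x • a) ★ (y • b)).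
Proof.
by rewrite /pa_prod pa_mul_morph (linear_sum_fun (@pa_mul_linear _ _ _ A)).
Qed.

(** By [eps_act], h2 • (g • b) is the sum of ε_h2 ((h3 g) • b); balancing moves ε_h2 to the right of
    h1 • a, where [act_eps] absorbs it. *)
Lemma pa_actM h g a b :
  h • (a ★ (g • b)) = sw h (fun x y => (x • a) ★ ((y * g) • b)).
Proof.
rewrite act_pa_prod.
under eq_sw => x y do rewrite -eps_act (raddf_sw _ _ (Mr _)).
under eq_sw => x y do under eq_sw => u v do rewrite -pa_prod_eps.
rewrite -(swA (f := fun x u v =>
  sw u (fun c d => d • T c • x • a) ★ ((v * g) • b))); try by lin.
apply: eq_sw => w v; rewrite -(raddf_sw _ _ (Ml _)); congr (_ ★ _).
rewrite -[a in RHS](pact1 A) -act_eps.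
by apply: eq_sw => x u; apply: eq_sw => c d; rewrite mulr1.
Qed.

(** Mirror of [pa_actM], with [eps_act] and [act_eps] exchanged. *)
Lemma pa_act_sym h g a b :
  h • ((g • b) ★ a) = sw h (fun x y => ((x * g) • b) ★ (y • a)).
Proof.
rewrite act_pa_prod.
under eq_sw => x y do rewrite -act_eps (raddf_sw _ _ (Ml _)).
under eq_sw => x y do under eq_sw => u v do rewrite pa_prod_eps.
rewrite (swA (f := fun x u v =>
  ((x * g) • b) ★ sw u (fun c d => c • S d • v • a))); try by lin.
apply: eq_sw => u z; rewrite -(raddf_sw _ _ (Mr _)); congr (_ ★ _).
rewrite -[a in RHS](pact1 A) -eps_act.
by apply: eq_sw => v y; apply: eq_sw => c d; rewrite mulr1.
Qed.

Definition pma_of_par_algebra : partial_module_algebra H B :=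
  PartialModuleAlgebra pa_prod_linearl pa_prod_linearr pa_prodA
    (pact_linearl A) (pact_linearr A) (pact1 A) pa_actM.

End PartialActionOfAlgebra.

(** * Extensionality and the correspondence *)

Lemma partial_module_eq (k : fieldType) (H : hopfAlgebra k) (B : lmodType k)
  (P Q : partial_module H B) : (forall h m, P h m = Q h m) -> P = Q.
Proof.
case: P Q => [p p1 p2 p3 p4 p5] [q q1 q2 q3 q4 q5] /= e.
have {}e : p = q by apply/funext => h; apply/funext => m; apply: e.
by case: q / e q1 q2 q3 q4 q5 => *; congr PartialModule; apply: Prop_irrelevance.
Qed.

(** The domain of the multiplication depends on the module, so the modules are identified first;
    then a linear map is determined on pure tensors. *)
Lemma par_algebra_eq (k : fieldType) (H : hopfAlgebra k) (B : lmodType k)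
  (A A' : par_algebra H B) : (forall h m, A h m = A' h m) ->
  (forall a b, pa_prod A a b = pa_prod A' a b) -> A = A'.
Proof.
rewrite /pa_prod => /partial_module_eq.
case: A A' => [P m m1 m2 m3] [Q n n1 n2 n3] /= e.
case: Q / e n n1 n2 n3 => n n1 n2 n3 e.
have {}e : m = n.
  apply/funext => t; rewrite [t]tensorE !linear_sum_fun //.
  by apply: eq_bigr => p _; apply: e.
by case: n / e n1 n2 n3 => *; congr ParAlgebra; apply: Prop_irrelevance.
Qed.

Lemma partial_module_algebra_eq (k : fieldType) (H : hopfAlgebra k)
  (B : lmodType k) (A A' : partial_module_algebra H B) :
  (forall h m, pma_act A h m = pma_act A' h m) ->
  (forall a b, pma_prod A a b = pma_prod A' a b) -> A = A'.
Proof.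
case: A A' => [m m1 m2 m3 p p1 p2 p3 p4] [n n1 n2 n3 q q1 q2 q3 q4] /= e e'.
have {}e : p = q by apply/funext => h; apply/funext => x; apply: e.
have {}e' : m = n by apply/funext => a; apply/funext => b; apply: e'.
subst q n; rewrite (Prop_irrelevance m1 n1) (Prop_irrelevance m2 n2).
rewrite (Prop_irrelevance m3 n3) (Prop_irrelevance p1 q1).
rewrite (Prop_irrelevance p2 q2) (Prop_irrelevance p3 q3).
by rewrite (Prop_irrelevance p4 q4).
Qed.

Theorem theorem22 (k : fieldType) (H : hopfAlgebra k)
    (bijS : bijective (@antipode k H)) (B : lmodType k) :
  exists F : {A : par_algebra H B | admissible_prod (pa_prod A)} ->
             {A : partial_module_algebra H B |
                symmetrical A /\ admissible_prod (pma_prod A)},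
  [/\ bijective F,
      forall A h b, pma_act (sval (F A)) h b = sval A h b
    & forall A a b, pma_prod (sval (F A)) a b = pa_prod (sval A) a b].
Proof.
pose F (A : {A : par_algebra H B | admissible_prod (pa_prod A)}) :
    {A : partial_module_algebra H B |
       symmetrical A /\ admissible_prod (pma_prod A)} :=
  exist _ (pma_of_par_algebra bijS (sval A))
    (conj (@pa_act_sym _ _ _ bijS (sval A)) (proj2_sig A)).
(* [F] keeps the action and the product, so the last two claims hold by computation. *)
exists F; split=> //.
have adm (A : partial_module_algebra H B)
    (sA : symmetrical A) (aA : admissible_prod (pma_prod A)) :
    admissible_prod (pa_prod (par_algebra_of_pma sA bijS aA)).
  suff -> : pa_prod (par_algebra_of_pma sA bijS aA) = pma_prod A by [].
  by apply/funext => a; apply/funext => b; apply: pma_tensor_mul_pure.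
pose G (A : {A : partial_module_algebra H B |
                symmetrical A /\ admissible_prod (pma_prod A)}) :
    {A : par_algebra H B | admissible_prod (pa_prod A)} :=
  exist _ (par_algebra_of_pma (proj2_sig A).1 bijS (proj2_sig A).2)
    (adm _ (proj2_sig A).1 (proj2_sig A).2).
(* Both round trips keep the action by computation; the product is recovered by evaluating the
   induced map on pure tensors. *)
exists G => [[A adA]|[A [sA adA]]]; apply: eq_exist => /=.
  apply: par_algebra_eq => // a b.
  exact: pma_tensor_mul_pure.
apply: partial_module_algebra_eq => // a b.
exact: pma_tensor_mul_pure.
Qed.
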